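(* Let $N\ge 1$ and $1\le K\le N$ be integers. In the 2-Choice case of the Sliding-Window Secretary Problem with $N$ applicants and window size $K$, the optimal strategy has at most two thresholds: there are integers $\delta_1^*,\delta_2^*\ge 0$ such that the following strategy maximizes the probability of winning among all strategies of the interviewer. Reject the first $\delta_1^*$ applicants, choose the first candidate $m_1$ after $\delta_1^*$ with the sliding rule, and then choose the first candidate $m_2$ after both $m_1$ and $\delta_2^*$.
   Context: Setting (2-Choice case). There are $N$ applicants, seen in the order of their indices $1,\dots,N$. $R$ is a uniformly random permutation of $\{1,\dots,N\}$; $R(m)$ is the absolute rank of the applicant at index $m$, with $1$ the best rank. The interviewer knows $N$ and $K$ and observes only relative ranks of the applicants seen so far. When the window starts at index $i$, it consists of applicants $i,\dots,\min(i+K-1,N)$, and exactly the applicants $1,\dots,\min(i+K-1,N)$ have been seen; at this moment the interviewer may choose applicants in the window, and then the window moves to start at $i+1$, applicant $i$ being lost if not chosen. At most two applicants in total can be chosen, and the interviewer wins iff one of the chosen applicants has rank $1$. A strategy is any rule making these decisions from the relative ranks observed so far. A candidate is an applicant in the current window having the best rank among all applicants seen so far. The sliding rule: the window is advanced until a candidate is at its smallest index. Thus, under the sliding rule, the applicant at index $i$ is a candidate iff $R(i)=\min\{R(1),\dots,R(\min(i+K-1,N))\}$, and ''the first candidate after $x$'' is the first index $i>x$ with this property. *)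

(* Defs.v *)
From mathcomp Require Import all_boot all_order all_fingroup all_algebra.

Set Implicit Arguments.
Unset Strict Implicit.
Unset Printing Implicit Defensive.

(* The applicant of index m (1 <= m <= N) is the ordinal i : 'I_N with
   i.+1 = m.  A ranking is R : {perm 'I_N}; the absolute rank of i is
   (R i).+1.  Thresholds count applicants, so "after x" reads x < i.+1. *)

Section SlidingWindow.

Variables (N K : nat).
Implicit Types (R : {perm 'I_N}) (i j l m : 'I_N).

(* Index min(i+K-1, N) in 1-based terms becomes the bound j < i + K, the cap
   by N being enforced by the type of j. *)
Definition seen i : {set 'I_N} := [set j : 'I_N | j < i + K].

Definition window i : {set 'I_N} := [set j in seen i | i <= j].

Definition relative_rank R (A : {set 'I_N}) j : nat := #|[set l in A | R l <= R j]|.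

(* Relative ranks, in order of arrival, of everyone seen when the window starts
   at i.  They determine everything observed at earlier window positions. *)
Definition observed R i : seq nat :=
  [seq relative_rank R (seen i) j | j <- enum (seen i)].

(* D R i is the set of applicants chosen, under ranking R, while the window
   starts at i. *)
Definition decisions := {perm 'I_N} -> 'I_N -> {set 'I_N}.

Definition chosen (D : decisions) R : {set 'I_N} := \bigcup_(i : 'I_N) D R i.

Definition is_strategy (D : decisions) : Prop :=
  [/\ forall i, exists rule : seq nat -> {set 'I_N},
        forall R, D R i = rule (observed R i),
      forall R i, D R i \subset window i
    & forall R, #|chosen D R| <= 2].

Definition wins (D : decisions) R : bool :=
  [exists j in chosen D R, (R j).+1 == 1].

Definition win_probability (D : decisions) : rat :=
  (#|[set R | wins D R]|%:R / #|[set: {perm 'I_N}]|%:R)%R.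

(* Candidate under the sliding rule: i is the best of all the applicants seen
   when the window starts at i. *)
Definition candidate R i : bool := [forall j in seen i, R i <= R j].

Definition first_candidate_after R (x : nat) m : bool :=
  [&& candidate R m, x < m.+1 &
      [forall l, (candidate R l && (x < l.+1)) ==> (m <= l)]].

Definition is_m1 (d1 : nat) R m : bool := first_candidate_after R d1 m.

Definition is_m2 (d1 d2 : nat) R m : bool :=
  [exists m1, is_m1 d1 R m1 && first_candidate_after R (maxn m1.+1 d2) m].

(* m1 and m2, when they exist, are chosen as they reach the left end of the
   window. *)
Definition threshold_strategy (d1 d2 : nat) : decisions := fun R i =>
  [set m | (m == i) && (is_m1 d1 R m || is_m2 d1 d2 R m)].

End SlidingWindow.

(* Main.v *)
Require Import Defs.
From mathcomp Require Import all_boot all_order all_fingroup all_algebra.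
From mathcomp Require Import zify ring lra.

(** Choosing anything but a candidate at the left end of the window is useless,
    since a best applicant chosen early becomes such a candidate in due time.
    Given the relative ranks seen so far, a candidate at [i] wins with
    probability a_i = min(i+K,N)/N, and [m] becomes a candidate with probability
    1/min(m+K,N) as long as the window has not reached it.  If w_c is the
    optimal value with [c] choices left, choosing a candidate at [i] is right iff
    a_i >= w_c(i+K) - w_(c-1)(i+K).  A Doob decomposition turns this into the
    exact loss of an arbitrary strategy against w_2(0).  The rule is a threshold
    rule because a_i increases, while w_1 and w_2 - w_1 decrease; the latter
    follows from w_2 - w_1 <= w_1. *)

Set Implicit Arguments.
Unset Strict Implicit.
Unset Printing Implicit Defensive.

Import Order.TTheory GRing.Theory Num.Theory.

(** * Uniform random rankings *)

Definition same_order (N t : nat) (R R' : {perm 'I_N}) : Prop :=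
  forall j l : 'I_N, j < t -> l < t -> (R j <= R l) = (R' j <= R' l).

(** Measurability of [f] with respect to the relative ranks of the first [t] applicants. Sums of
    such [f] over events replace conditional probabilities throughout. *)
Definition order_determined (N t : nat) (T : Type) (f : {perm 'I_N} -> T) : Prop :=
  forall R R', same_order t R R' -> f R = f R'.

Section Ranking.

Local Open Scope ring_scope.

Variable N : nat.
Implicit Types (R : {perm 'I_N}) (i j l m p : 'I_N).

Lemma order_determinedW (T : Type) s t (f : {perm 'I_N} -> T) :
  (s <= t)%N -> order_determined s f -> order_determined t f.
Proof.
move=> st fs R R' RR'; apply: fs => j l js ls.
by apply: RR'; apply: leq_trans st.
Qed.

(* Exchanging the adjacent ranks [v] and [w] does not affect the relative order
   of the applicants before [p]. *)
Lemma sum_rank_succ t (f : {perm 'I_N} -> rat) p (v w : 'I_N) :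
  order_determined t f -> (t <= p)%N -> w = v.+1 :> nat ->
  \sum_(R : {perm 'I_N} | R p == w) f R = \sum_(R : {perm 'I_N} | R p == v) f R.
Proof.
move=> ft tp wv.
rewrite (reindex_inj (mulIg (tperm v w))) /=.
apply: eq_big => [R|R].
  by rewrite permM -[X in _ == X](tpermL v w) (inj_eq perm_inj).
rewrite permM -[X in _ == X](tpermL v w) (inj_eq perm_inj) => /eqP Rp.
apply: ft => j l jt lt; rewrite !permM.
(* Rank [v] belongs to [p], hence to nobody before [t]; the swap can only lower one early rank from
   [w] to the free rank [v], which keeps every comparison. *)
have ne (k : 'I_N) : (k < t)%N -> R k <> v.
  by rewrite -Rp => kt /perm_inj kp; move: kt; rewrite kp ltnNge tp.
have nj := ne _ jt; have nl := ne _ lt.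
have vn (x : 'I_N) : x <> v -> x <> v :> nat by move=> xv /val_inj.
have wn (x : 'I_N) : x <> w -> x <> v.+1 :> nat by rewrite -wv => xv /val_inj.
case: tpermP => [//|->|_ /wn jw]; case: tpermP => [//|->|_ /wn lw]; rewrite ?leqnn //.
- by move/eqP/negbTE: (vn _ nl) => nlv; rewrite wv [LHS]leq_eqVlt eq_sym nlv.
- by move/eqP/negbTE: jw => njw; rewrite wv [RHS]leq_eqVlt ltnS njw.
Qed.

(** The rank of [p] is uniform and independent of the order before [t]: by [sum_rank_succ] all [N]
    values of [R p] contribute equally. *)
Lemma sum_best_after t (f : {perm 'I_N} -> rat) p :
  order_determined t f -> (t <= p)%N ->
  N%:R * \sum_(R : {perm 'I_N} | R p == 0%N :> nat) f R = \sum_R f R.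
Proof.
move=> ft tp.
have N0 : (0 < N)%N by apply: leq_ltn_trans (ltn_ord p).
rewrite [RHS](partition_big (fun R : {perm 'I_N} => R p) xpredT) //=.
have E v : \sum_(R : {perm 'I_N} | R p == v) f R =
           \sum_(R : {perm 'I_N} | R p == 0%N :> nat) f R.
  case: v => v; elim: v => [|v IH] vN; first by [].
  by rewrite -(IH (ltnW vN)); apply: sum_rank_succ ft tp _.
by under eq_bigr do rewrite E; rewrite sumr_const card_ord mulr_natl.
Qed.

Variable K : nat.

Lemma candidateP R i :
  reflect (forall j, (j < i + K)%N -> (R i <= R j)%N) (candidate K R i).
Proof.
apply: (iffP forallP) => H j.
  by move=> ji; move: (H j); rewrite inE ji.
by apply/implyP; rewrite inE => /H.
Qed.

Lemma best_candidate R i : R i = 0%N :> nat -> candidate K R i.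
Proof. by move=> Ri; apply/candidateP => j _; rewrite Ri. Qed.

Lemma order_determined_candidate i :
  (0 < K)%N -> order_determined (i + K) (fun R : {perm 'I_N} => candidate K R i).
Proof.
move=> K0 R R' RR'; have ii : (i < i + K)%N by lia.
by apply/candidateP/candidateP => H j ji; [rewrite -RR'|rewrite RR'] => //; apply: H.
Qed.

Lemma card_ord_geq n : #|[pred p : 'I_N | (n <= p)%N]| = (N - n)%N.
Proof.
rewrite -sum1_card -(big_geq_mkord n N xpredT (fun=> 1%N)).
by rewrite sum_nat_const_nat muln1.
Qed.

(** Sort the rankings with a candidate at [i] by the position [p] of the overall best. Either
    [p = i], or [p] is unseen and [sum_best_after] gives each such [p] a share 1/N of the total;
    what remains for [i] is min(i+K,N)/N. *)
Lemma sum_candidate_best (f : {perm 'I_N} -> rat) i :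
  (0 < K)%N -> order_determined (i + K) f ->
  N%:R * \sum_(R : {perm 'I_N} | R i == 0%N :> nat) f R
  = (minn (i + K) N)%:R * \sum_(R | candidate K R i) f R.
Proof.
move=> K0 fi.
have N0 : (0 < N)%N by apply: leq_ltn_trans (ltn_ord i).
pose v0 := Ordinal N0.
pose f' R := if candidate K R i then f R else 0.
have f'i : order_determined (i + K) f'.
  by move=> R R' RR'; rewrite /f' (order_determined_candidate K0 RR') (fi _ _ RR').
rewrite big_mkcond /= [X in _ = _ * X]big_mkcond /= -/f'.
set T := \sum_R _; set S := \sum_R _.
have TE : T = \sum_(R : {perm 'I_N} | R i == v0) f' R.
  rewrite /T [RHS]big_mkcond /=; apply: eq_bigr => R _; rewrite /f' -val_eqE /=.
  by case: eqP => // /best_candidate ->.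
have SE : S = \sum_(p : 'I_N) \sum_(R : {perm 'I_N} | R p == v0) f' R.
  rewrite /S (partition_big (fun R : {perm 'I_N} => (R^-1)%g v0) xpredT) //=.
  apply: eq_bigr => p _; apply: eq_bigl => R.
  by rewrite eq_sym -(inj_eq (@perm_inj _ R)) permKV.
have after p : (i + K <= p)%N ->
    N%:R * \sum_(R : {perm 'I_N} | R p == v0) f' R = S.
  by move=> ip; exact: (sum_best_after f'i ip).
have before p : (p < i + K)%N -> p != i -> \sum_(R : {perm 'I_N} | R p == v0) f' R = 0.
  move=> pi npi; apply: big1 => R /eqP Rp; rewrite /f'; case: candidateP => // /(_ _ pi).
  rewrite Rp leqn0 => /eqP Ri; case/eqP: npi; apply: (@perm_inj _ R).
  by rewrite Rp; apply: val_inj.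
have H : N%:R * S = N%:R * T + (N - (i + K))%:R * S.
  rewrite {1}SE (bigD1 i) //= -TE mulrDr; congr (_ + _).
  rewrite (bigID (fun p : 'I_N => i + K <= p)%N) /= [X in _ + X]big1 ?addr0; last first.
    by move=> p /andP[npi]; rewrite -ltnNge => pi; apply: before.
  rewrite mulr_sumr (eq_bigr (fun=> S)); last by move=> p /andP[_ /after].
  rewrite sumr_const mulr_natl -card_ord_geq; congr (_ *+ _).
  apply: eq_card => p; change ((p != i) && (i + K <= p) = (i + K <= p))%N.
  by case: (eqVneq p i) => [->|//]; apply/esym/negbTE; rewrite -ltnNge; lia.
have natE : N%:R = (minn (i + K) N)%:R + (N - (i + K))%:R :> rat.
  by rewrite -natrD; congr (_%:R); lia.
by move: H; rewrite [X in X * S]natE mulrDl => /addIr ->.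
Qed.

(** The candidate event at [i] is independent of the order before [i]: the two preceding lemmas
    evaluate the same sum over [R i = 0]. *)
Lemma sum_candidate (f : {perm 'I_N} -> rat) i :
  (0 < K)%N -> order_determined i f ->
  \sum_(R | candidate K R i) f R = (minn (i + K) N)%:R^-1 * \sum_R f R.
Proof.
move=> K0 fi.
have fiK : order_determined (i + K) f by apply: order_determinedW fi; lia.
have n0 : (minn (i + K) N)%:R != 0 :> rat by rewrite pnatr_eq0; have := ltn_ord i; lia.
rewrite -(sum_best_after fi (leqnn i)) (sum_candidate_best K0 fiK).
by rewrite mulKf.
Qed.

(** Along the elements of [T] in increasing order, [count] runs through 0, 1, 2, ..., so the sum
    telescopes. *)
Lemma sum_count_telescope (T : {set 'I_N}) (h : nat -> rat) b :
  let count b := #|[set j in T | (j < b)%N]| in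
  \sum_(i in T | (i < b)%N) (h (count i) - h (count i).+1) = h 0%N - h (count b).
Proof.
move=> count; elim: b => [|b IH].
  rewrite big_pred0 => [|i]; last by rewrite andbF.
  by rewrite /count (_ : finset _ = set0) ?cards0 ?subrr //; apply/setP => j; rewrite !inE andbF.
have [/existsP[i0 /andP[i0T /eqP i0b]]|nex] := boolP [exists i in T, i == b :> nat].
  rewrite (bigD1 i0) /=; last by rewrite i0T i0b leqnn.
  rewrite (eq_bigl (fun i => (i \in T) && (i < b)%N)); last first.
    move=> i; rewrite -val_eqE /= i0b ltnS [(i <= b)%N]leq_eqVlt -andbA.
    by case: eqP => [->|]; rewrite ?ltnn ?andbT //= andbF.
  rewrite IH i0b.
  have -> : count b.+1 = (count b).+1.
    rewrite /count (cardsD1 i0) !inE i0T i0b leqnn add1n; congr _.+1.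
    apply: eq_card => i; rewrite !inE -val_eqE /= i0b ltnS [(i <= b)%N]leq_eqVlt.
    by case: eqP => [->|]; rewrite ?ltnn ?andbF.
  by rewrite addrC addrA subrK.
have E i : (i \in T) && (i < b.+1)%N = (i \in T) && (i < b)%N.
  rewrite ltnS [(i <= b)%N]leq_eqVlt; case: eqP => //= ib.
  move: nex; rewrite negb_exists => /forallP/(_ i); rewrite ib eqxx andbT => /negbTE ->.
  by [].
rewrite (eq_bigl _ _ E) IH; congr (_ - h _).
by apply: eq_card => i; rewrite !inE E.
Qed.

(** * Selecting among the candidates at the left end *)

Section Selection.

Variable S : {perm 'I_N} -> {set 'I_N}.
Hypothesis K_gt0 : (0 < K)%N.
Hypothesis S_candidate : forall R i, i \in S R -> candidate K R i.
Hypothesis S_determined :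
  forall i, order_determined (i + K) (fun R : {perm 'I_N} => i \in S R).

Definition used R b := #|[set j in S R | (j < b)%N]|.

Lemma sum_selected (F : {perm 'I_N} -> 'I_N -> rat) :
  \sum_R \sum_(i in S R) F R i = \sum_i \sum_(R | candidate K R i) (i \in S R)%:R * F R i.
Proof.
under eq_bigr do rewrite big_mkcond /=.
rewrite exchange_big /=; apply: eq_bigr => i _.
rewrite [RHS]big_mkcond /=; apply: eq_bigr => R _.
case: ifP => [iS|]; first by rewrite (S_candidate iS) mul1r.
by rewrite mul0r if_same.
Qed.

Lemma sum_wins_selected :
  \sum_R \sum_(i in S R) (R i == 0%N :> nat)%:R
  = \sum_R \sum_(i in S R) (minn (i + K) N)%:R / N%:R :> rat.
Proof.
rewrite !sum_selected; apply: eq_bigr => i _.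
have N0 : N%:R != 0 :> rat by rewrite pnatr_eq0; have := ltn_ord i; lia.
have fi : order_determined (i + K) (fun R : {perm 'I_N} => (i \in S R)%:R : rat).
  by move=> R R' /S_determined ->.
apply: (mulfI N0); rewrite -mulr_suml [RHS]mulrCA [N%:R * (_ / _)]mulrC divfK //.
rewrite [RHS]mulrC -(sum_candidate_best K_gt0 fi); congr (_ * _).
rewrite [LHS]big_mkcond [RHS]big_mkcond; apply: eq_bigr => R _.
case: eqP => [Ri|_]; first by rewrite (best_candidate Ri) mulr1.
by rewrite mulr0 if_same.
Qed.

(* Candidates are at least [K] apart, so no choice is made within the last
   [K - 1] indices before a candidate. *)
Lemma used_candidate R i : candidate K R i -> used R i = used R (i.+1 - K).
Proof.
move=> /candidateP ci; apply: eq_card => j; rewrite !inE.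
have [jS|//] := boolP (j \in S R); rewrite /=.
have [ji|ij] := ltnP j i; last by apply/esym/negbTE; rewrite -leqNgt; lia.
rewrite ltn_subRL addnC; have [iK|iK] := ltnP (j + K) i.+1 => //.
have /candidateP/(_ i iK) jlei := S_candidate jS.
have ilej : (R i <= R j)%N by apply: ci; lia.
have /val_inj/perm_inj ij : R i = R j :> nat by apply/eqP; rewrite eqn_leq ilej.
by move: ji; rewrite ij ltnn.
Qed.

(** Only choices at [j] with [j + K <= b] are counted, and these depend on the first [j + K]
    applicants. The shift by [K] is what makes [sum_candidate] applicable at [b]. *)
Lemma used_determined b : order_determined b (fun R => used R (b.+1 - K)).
Proof.
move=> R R' RR'; apply: eq_card => j; rewrite !inE ltn_subRL addnC ltnS.
have [jb|] := leqP (j + K) b; rewrite ?andbF //.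
by rewrite (@S_determined j R R') // => l l' lj l'j; apply: RR'; lia.
Qed.

(* Doob decomposition of the sum of [g] over the candidates: at each index [m]
   the conditional probability of a candidate is 1/min(m+K,N). *)
Lemma sum_value (g W : nat -> nat -> rat) :
  (forall k n, W k n = \sum_(m < N | (n <= m)%N) (minn (m + K) N)%:R^-1 * g k m) ->
  \sum_R (\sum_(i | candidate K R i) g (used R i) i
    + \sum_(i in S R) (W (used R i) (i + K)%N - W (used R i).+1 (i + K)%N))
  = \sum_(R : {perm 'I_N}) W 0%N 0%N.
Proof.
move=> WE; rewrite big_split /=.
have -> : \sum_R \sum_(i | candidate K R i) g (used R i) i =
    \sum_R \sum_(i : 'I_N) (minn (i + K) N)%:R^-1 * g (used R (i.+1 - K)) i.
  under eq_bigr do rewrite big_mkcond /=.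
  rewrite exchange_big [RHS]exchange_big /=; apply: eq_bigr => i _.
  rewrite -mulr_sumr -sum_candidate //; last first.
    by move=> R R' /used_determined ->.
  rewrite [RHS]big_mkcond /=; apply: eq_bigr => R _.
  by case: ifP => // /used_candidate ->.
rewrite -big_split /=; apply: eq_bigr => R _.
rewrite WE.
(* A choice at [i] alters the counter seen at [m] exactly when [i + K <= m]; for fixed [m] the
   alterations telescope from 0 to the current count. *)
have -> : \sum_(i in S R) (W (used R i) (i + K)%N - W (used R i).+1 (i + K)%N) =
   \sum_(m < N) (minn (m + K) N)%:R^-1 * (g 0%N m - g (used R (m.+1 - K)) m).
  under eq_bigr do rewrite !WE -sumrB big_mkcond /=.
  rewrite exchange_big /=; apply: eq_bigr => m _.
  rewrite -(sum_count_telescope (S R) (g^~ m)) mulr_sumr big_mkcondr /=.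
  apply: eq_bigr => i _; rewrite ltn_subRL addnC ltnS.
  by case: ifP => // _; rewrite mulrBr.
by rewrite -big_split /=; apply: eq_big => // i _; rewrite -mulrDr addrC subrK.
Qed.

End Selection.
End Ranking.

(** * Value functions *)

Section Value.

Local Open Scope ring_scope.

Variables N K : nat.

Definition best_probability n : rat := (minn (n + K) N)%:R / N%:R.

(** Advantage of the better decision over rejecting a candidate at [n]. The continuation is read at
    [n + K] because no further candidate can occur before it. *)
Definition gain (u w : nat -> rat) n : rat :=
  Num.max 0 (best_probability n - (w (n + K)%N - u (n + K)%N)).

(* Bellman equation at a window start with no candidate pending: [w] is the
   value of the remaining choices, [u] the value after one of them is used. *)
Definition is_value (u w : nat -> rat) : Prop :=
  (forall n, (N <= n)%N -> w n = 0) /\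
  forall n, (n < N)%N -> w n = w n.+1 + (minn (n + K) N)%:R^-1 * gain u w n.

Lemma backward_ind (P : nat -> Prop) :
  (forall n, (N <= n)%N -> P n) ->
  (forall n, (n < N)%N -> (forall m, (n < m)%N -> P m) -> P n) ->
  forall n, P n.
Proof.
move=> P0 PS n; have [k] := ubnP (N - n)%N; elim: k n => // k IH n nk.
have [|nN] := leqP N n; first exact: P0.
apply: PS => // m nm; have [|mN] := leqP N m; first exact: P0.
by apply: IH; lia.
Qed.

Lemma value_expand (w g : nat -> rat) :
  (forall n, (N <= n)%N -> w n = 0) ->
  (forall n, (n < N)%N -> w n = w n.+1 + (minn (n + K) N)%:R^-1 * g n) ->
  forall n, w n = \sum_(m < N | (n <= m)%N) (minn (m + K) N)%:R^-1 * g m.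
Proof.
move=> w0 wS n; rewrite -(big_geq_mkord n N xpredT (fun m => (minn (m + K) N)%:R^-1 * g m)).
elim/backward_ind: n => [n nN|n nN IH]; first by rewrite w0 ?big_geq.
by rewrite big_ltn // -IH // wS // addrC.
Qed.

Lemma weight_ge0 n : 0 <= (minn (n + K) N)%:R^-1 :> rat.
Proof. by rewrite invr_ge0 ler0n. Qed.

Lemma gain_ge0 u w n : 0 <= gain u w n.
Proof. by rewrite /gain le_max lexx. Qed.

Lemma nonincreasing_of_step (x : nat -> rat) :
  (forall n, x n.+1 <= x n) -> forall m n, (m <= n)%N -> x n <= x m.
Proof.
move=> xS m n /subnKC <-; elim: (n - m)%N => [|d IH]; first by rewrite addn0.
by rewrite addnS; apply: le_trans IH.
Qed.

Lemma value_nonincreasing u w : is_value u w ->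
  forall m n, (m <= n)%N -> w n <= w m.
Proof.
move=> [w0 wS]; apply: nonincreasing_of_step => n.
have [nN|Nn] := ltnP n N; last by rewrite !w0 // ltnW.
by rewrite [w n]wS // lerDl mulr_ge0 ?weight_ge0 ?gain_ge0.
Qed.

Lemma threshold_exists (x : nat -> rat) :
  (forall m n, (m <= n)%N -> x n <= x m) ->
  exists d, forall n, (n < N)%N -> (d <= n)%N = (x (n + K)%N <= best_probability n).
Proof.
move=> xD; pose good n := x (n + K)%N <= best_probability n.
have goodW m n : (m <= n)%N -> good m -> good n.
  move=> mn; rewrite /good => xm; apply: le_trans (xD (m + K)%N _ _) _; first by lia.
  apply: le_trans xm _; rewrite ler_wpM2r ?invr_ge0 ?ler0n // ler_nat; lia.
(* The second disjunct makes the threshold default to at most [N] when no index is good. *)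
have ex : exists n, good n || (N <= n)%N by exists N; rewrite leqnn orbT.
exists (ex_minn ex); case: ex_minnP => d gd dmin n nN.
apply/idP/idP => [dn|gn]; last by apply: dmin; rewrite -/(good n) /good gn.
by case/orP: gd => [|Nd]; [apply: goodW | lia].
Qed.

Hypothesis K_gt0 : (0 < K)%N.

Lemma value_exists u : exists w, is_value u w.
Proof.
(* Build [w] backwards: the equation holds on the last [k] indices, and each step redefines one
   value. Since [K] is positive, [gain] at [n] reads only indices above [n]. *)
suff H k : exists w : nat -> rat, (forall n, (N <= n)%N -> w n = 0) /\
    forall n, (n < N)%N -> (N <= n + k)%N ->
      w n = w n.+1 + (minn (n + K) N)%:R^-1 * gain u w n.
  have [w [w0 wS]] := H N; exists w; split=> // n nN.
  by apply: wS => //; apply: leq_addl.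
elim: k => [|k [w [w0 wS]]].
  by exists (fun=> 0); split=> // n nN; rewrite addn0 leqNgt nN.
have [Nk|kN] := leqP N k.
  by exists w; split=> // n nN _; apply: wS => //; lia.
pose v (n : nat) : rat := if n == (N - k.+1)%N
  then w n.+1 + (minn (n + K) N)%:R^-1 * gain u w n else w n.
have vw n : (N - k.+1 < n)%N -> v n = w n by move=> nk; rewrite /v; case: eqP => //; lia.
exists v; split=> [n nN|n nN nk]; first by rewrite vw ?w0 //; lia.
have gE : gain u v n = gain u w n by rewrite /gain vw //; lia.
rewrite gE (vw n.+1); last by lia.
rewrite {1}/v; case: eqP => // nN'; apply: wS => //; lia.
Qed.

(** * Monotonicity of the value of an additional choice *)

Section TwoChoices.

Variables w1 w2 : nat -> rat.
Hypothesis w1V : is_value (fun=> 0) w1.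
Hypothesis w2V : is_value w1 w2.

(* A bound [2 w1 - w2 >= 0] alone does not survive the recursion; the induction
   goes through for the monotonicity of [(2 w1 n - w2 n) / n], which reflects
   that a record at [n] is still the best of the first [u] with probability
   [n / u]. *)
Lemma excess_monotone n :
  0 <= 2 * w1 n - w2 n /\
  forall u, (n <= u)%N -> n%:R * (2 * w1 u - w2 u) <= u%:R * (2 * w1 n - w2 n).
Proof.
have [w10 w1S] := w1V; have [w20 w2S] := w2V.
pose E n := 2 * w1 n - w2 n; rewrite -/(E n).
suff : 0 <= E n /\ forall u, (n <= u)%N -> n%:R * E u <= u%:R * E n by [].
elim/backward_ind: n => [n nN|n nN IH].
  have E0 m : (n <= m)%N -> E m = 0 by move=> nm; rewrite /E w10 ?w20 ?mulr0 ?subrr //; lia.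
  by rewrite E0 //; split=> // u nu; rewrite !E0 // !mulr0.
have [E1 E1u] := IH n.+1 (ltnSn n).
have [E'0 _] := IH (n + K)%N ltac:(lia).
pose q : rat := (minn (n + K) N)%:R^-1.
have q0 : 0 <= q by apply: weight_ge0.
have qE : n.+1%:R * q * E (n + K)%N <= E n.+1.
  have [nK|nK] := leqP (n + K) N; last first.
    by rewrite {1}/E w10 ?w20 ?mulr0 ?subrr ?mulr0 // ltnW.
  rewrite /q (minn_idPl nK) mulrAC ler_pdivrMr ?ltr0n; last by lia.
  by rewrite [E _ * _]mulrC; apply: E1u; lia.
have step : n%:R * E n.+1 <= n.+1%:R * E n.
  have En : E n = E n.+1 + q * (2 * gain (fun=> 0) w1 n - gain w1 w2 n).
    by rewrite /E w1S // w2S // -/q; ring.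
  (* The two gains are positive parts of numbers differing by [E (n + K)], so they differ by at most
     that; a further nonnegative gain is left over. Bound [qE] lets [E n.+1] pay for the term
     [E (n + K)]. *)
  have B : 0 <= E (n + K)%N + 2 * gain (fun=> 0) w1 n - gain w1 w2 n.
    move: E'0; rewrite /E /gain; set a := best_probability n.
    by case: (leP 0 (a - (w1 _ - 0))); case: (leP 0 (a - (w2 _ - _))); lra.
  have : 0 <= n.+1%:R * q * (E (n + K)%N + 2 * gain (fun=> 0) w1 n - gain w1 w2 n).
    by rewrite mulr_ge0 // mulr_ge0 // ler0n.
  by rewrite En; move: qE; rewrite -natr1; lra.
have En0 : 0 <= E n.
  rewrite -(pmulr_rge0 _ (ltr0Sn _ n)); apply: le_trans step.
  by rewrite mulr_ge0 ?ler0n.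
split=> // u; rewrite leq_eqVlt => /orP[/eqP<-//|nu].
rewrite -(ler_pM2l (ltr0Sn _ n)) mulrCA.
apply: (@le_trans _ _ (n%:R * (u%:R * E n.+1))).
  by rewrite ler_wpM2l ?ler0n //; apply: E1u.
by rewrite mulrCA [leRHS]mulrCA ler_wpM2l ?ler0n.
Qed.

(** One step back adds the weighted difference of the two gains, which is nonnegative because
    [w2 - w1 <= w1] at [n + K]. *)
Lemma second_value_nonincreasing m n : (m <= n)%N -> w2 n - w1 n <= w2 m - w1 m.
Proof.
have [w10 w1S] := w1V; have [w20 w2S] := w2V.
move: m n; apply: (@nonincreasing_of_step (fun n => w2 n - w1 n)) => n.
have [nN|Nn] := ltnP n N; last by rewrite !w10 ?w20 // ltnW.
have [E0 _] := excess_monotone (n + K).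
have : gain (fun=> 0) w1 n <= gain w1 w2 n.
  rewrite /gain; set a := best_probability n.
  by case: (leP 0 (a - (w1 _ - 0))); case: (leP 0 (a - (w2 _ - _))); lra.
by move=> /(ler_wpM2l (weight_ge0 n)); rewrite [w1 n]w1S // [w2 n]w2S //; lra.
Qed.

End TwoChoices.

End Value.

(** * Strategies *)

Section Strategies.

Variables N K : nat.
Hypothesis K_gt0 : 0 < K.
Implicit Types (R : {perm 'I_N}) (i j l m : 'I_N) (D : decisions N).

Lemma relative_rank_le R (A : {set 'I_N}) j l :
  j \in A -> l \in A -> (relative_rank R A j <= relative_rank R A l) = (R j <= R l).
Proof.
move=> jA lA; apply/idP/idP => [|jl]; last first.
  apply/subset_leq_card/subsetP => k; rewrite !inE => /andP[-> /=].
  by move=> /leq_trans; apply.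
apply: contraTT; rewrite -!ltnNge => lj.
apply/proper_card/properP; split; last first.
  by exists j; rewrite !inE ?jA ?leqnn //= -ltnNge.
apply/subsetP => k; rewrite !inE => /andP[-> /= kl].
by apply: leq_trans kl (ltnW lj).
Qed.

Lemma observedP R R' i :
  observed K R i = observed K R' i <-> same_order (i + K) R R'.
Proof.
split=> [/eq_in_map E j l ji li|E].
  have [jA lA] : j \in seen K i /\ l \in seen K i by rewrite !inE.
  by rewrite -(relative_rank_le R jA lA) -(relative_rank_le R' jA lA) !E ?mem_enum.
apply/eq_in_map => j; rewrite mem_enum inE => ji.
by apply: eq_card => l; rewrite !inE; case: ltnP => //= li; rewrite E.
Qed.

Lemma rule_exists D i :
  (exists rule : seq nat -> {set 'I_N}, forall R, D R i = rule (observed K R i))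
  <-> order_determined (i + K) (D ^~ i).
Proof.
split=> [[rule E] R R' /observedP RR'|E]; first by rewrite !E RR'.
(* Decide as for any ranking compatible with the observation; impossible observations get [set0]. *)
exists (fun s => if [pick R | observed K R i == s] is Some R then D R i else set0).
move=> R; case: pickP => [R' /eqP/observedP/E <- //|/(_ R)].
by rewrite eqxx.
Qed.

(** The choices that can still matter, each credited to the moment its applicant reaches the left
    end, whatever the earlier window [t] in which it was chosen. *)
Definition selected D R : {set 'I_N} :=
  [set i | candidate K R i && [exists t : 'I_N, (t <= i) && (i \in D R t)]].

Lemma selected_candidate D R i : i \in selected D R -> candidate K R i.
Proof. by rewrite inE => /andP[]. Qed.

Lemma card_selected D R : is_strategy K D -> #|selected D R| <= 2.
Proof.
case=> _ _ /(_ R); apply: leq_trans; apply/subset_leq_card/subsetP => i.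
rewrite inE => /andP[_ /existsP[t /andP[_ it]]].
by apply/bigcupP; exists t.
Qed.

Lemma selected_determined D i : is_strategy K D ->
  order_determined (i + K) (fun R => i \in selected D R).
Proof.
case=> Drule _ _ R R' RR'; rewrite !inE (order_determined_candidate K_gt0 RR').
congr (_ && _); apply: eq_existsb => t; case: leqP => //= ti.
have /rule_exists Dt := Drule t.
by rewrite (Dt R R') // => j l jt lt; apply: RR'; lia.
Qed.

(** The overall best applicant is a candidate on reaching the left end, so a winning choice is never
    discarded; rank 0 being unique, the sum is an indicator. *)
Lemma wins_selected D R : is_strategy K D ->
  ((wins D R)%:R = \sum_(i in selected D R) (R i == 0%N :> nat)%:R :> rat)%R.
Proof.
case=> _ Dw _.
have [/existsP[j /andP[jD Rj]]|nw] := boolP (wins D R).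
  have {}Rj : R j = 0 :> nat by move/eqP: Rj => [].
  have jS : j \in selected D R.
    rewrite inE best_candidate //=; case/bigcupP: jD => t _ jt.
    apply/existsP; exists t; rewrite jt andbT.
    by have /subsetP/(_ j jt) := Dw R t; rewrite inE => /andP[].
  rewrite (bigD1 j) //= Rj eqxx big1 ?addr0 // => i /andP[_ /eqP nij].
  case: eqP => // Ri; case: nij; apply: (@perm_inj _ R); apply: val_inj.
  by rewrite /= Ri Rj.
rewrite big1 // => i; rewrite inE => /andP[_ /existsP[t /andP[_ it]]].
case: eqP => // Ri; case/negP: nw; apply/existsP; exists i.
by rewrite Ri eqxx andbT; apply/bigcupP; exists t.
Qed.

Lemma win_probabilityE D : is_strategy K D ->
  (win_probability D
   = (\sum_R \sum_(i in selected D R) best_probability N K i) / #|[set: {perm 'I_N}]|%:R)%R.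
Proof.
move=> DS; rewrite /win_probability; congr (_ / _)%R.
rewrite -(sum_wins_selected K_gt0 (@selected_candidate D) (fun i => @selected_determined D i DS)).
rewrite -sum1_card natr_sum big_mkcond /=; apply: eq_bigr => R _.
by rewrite -wins_selected // inE; case: (wins D R).
Qed.

End Strategies.

(** * Threshold strategies *)

Section Threshold.

Variables N K d1 d2 : nat.
Hypothesis K_gt0 : 0 < K.
Implicit Types (R : {perm 'I_N}) (i j l m : 'I_N).

Local Notation T := (threshold_strategy K d1 d2 : decisions N).

Lemma first_candidate_exists R x i : candidate K R i -> x <= i ->
  exists2 m : 'I_N, m <= i & first_candidate_after K R x m.
Proof.
move=> ci xi; pose P l := candidate K R l && (x < l.+1).
have Pi : P i by rewrite /P ci.
case: (arg_minnP (P := P) (@nat_of_ord N) Pi) => m /andP[cm xm] mmin.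
exists m; first exact: mmin.
by rewrite /first_candidate_after cm xm; apply/forallP => l; apply/implyP/mmin.
Qed.

Lemma first_candidate_unique R x m m' :
  first_candidate_after K R x m -> first_candidate_after K R x m' -> m = m'.
Proof.
case/and3P=> cm xm /forallP mmin /and3P[cm' xm' /forallP m'min].
apply/val_inj/eqP; rewrite eqn_leq; apply/andP; split.
  by apply: (implyP (mmin m')); rewrite cm'.
by apply: (implyP (m'min m)); rewrite cm.
Qed.

Lemma first_candidate_determined x m :
  order_determined (m + K) (fun R : {perm 'I_N} => first_candidate_after K R x m).
Proof.
move=> R R' RR'.
have cE l : l <= m -> candidate K R l = candidate K R' l.
  by move=> lm; apply: order_determined_candidate => // j k jl kl; apply: RR'; lia.
rewrite /first_candidate_after cE //; congr [&& _, _ & _]; apply: eq_forallb => l.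
by have [lm|ml] := ltnP l m; [rewrite cE // ltnW | rewrite !implybT].
Qed.

Lemma is_m2_after_m1 R m : is_m2 K d1 d2 R m ->
  exists m1, [/\ is_m1 K d1 R m1, m1 < m & first_candidate_after K R (maxn m1.+1 d2) m].
Proof.
case/existsP=> m1 /andP[H1 H2]; exists m1; split=> //.
by case/and3P: H2 => _; rewrite gtn_max => /andP[].
Qed.

Lemma is_m2_determined m : order_determined (m + K) (fun R : {perm 'I_N} => is_m2 K d1 d2 R m).
Proof.
move=> R R' RR'; apply: eq_existsb => m1; rewrite (first_candidate_determined _ RR').
have [/and3P[_ + _]|] := boolP (first_candidate_after _ _ _ _); last by rewrite !andbF.
rewrite gtn_max => /andP[m1m _]; rewrite !andbT.
by apply: first_candidate_determined => j l jm lm; apply: RR'; lia.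
Qed.

Lemma is_m2_unique R m m' : is_m2 K d1 d2 R m -> is_m2 K d1 d2 R m' -> m = m'.
Proof.
move=> /is_m2_after_m1[m1 [m1P _ mP]] /is_m2_after_m1[m1' [m1'P _ m'P]].
apply: first_candidate_unique mP _.
by rewrite (first_candidate_unique m1P m1'P).
Qed.

Lemma threshold_is_strategy : is_strategy K T.
Proof.
split=> [i|R i|R].
- apply/rule_exists => R R' RR'; apply/setP => m; rewrite !inE.
  case: eqP => //= ->; rewrite (is_m2_determined RR').
  by rewrite /is_m1 (first_candidate_determined _ RR').
- apply/subsetP => m; rewrite !inE => /andP[/eqP-> _].
  by rewrite leqnn andbT; lia.
have card1 (P : pred 'I_N) : (forall m m', P m -> P m' -> m = m') -> #|[set m | P m]| <= 1.
  by move=> H; apply/card_le1_eqP => m m'; rewrite !inE => Pm Pm'; apply: H.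
apply: (@leq_trans #|[set m | is_m1 K d1 R m] :|: [set m | is_m2 K d1 d2 R m]|).
  by apply/subset_leq_card/subsetP => m /bigcupP[i _]; rewrite !inE => /andP[].
apply: leq_trans (leq_card_setU _ _) _; apply: (@leq_add _ _ 1 1); apply: card1.
  by move=> m m'; apply: first_candidate_unique.
exact: is_m2_unique.
Qed.

Lemma mem_selected_threshold R i :
  (i \in selected K T R) = is_m1 K d1 R i || is_m2 K d1 d2 R i.
Proof.
rewrite inE; apply/andP/idP => [[_ /existsP[t]]|H].
  by rewrite inE => /andP[_ /andP[]].
split; last by apply/existsP; exists i; rewrite leqnn inE eqxx.
by case/orP: H => [/and3P[]//|/is_m2_after_m1[m1 [_ _ /and3P[]]]].
Qed.

(** Turns the description by first candidates into a local test at each candidate, to be compared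
    with the Bellman decision: an earlier eligible candidate would already have been counted as
    used. *)
Lemma used_threshold R i : candidate K R i ->
  [/\ used (selected K T) R i = 0 -> (i \in selected K T R) = (d1 <= i)
    & used (selected K T) R i = 1 -> (i \in selected K T R) = (d2 <= i)].
Proof.
move=> ci; split=> ki.
  have none j : j < i -> j \notin selected K T R.
    move=> ji; apply/negP => jS.
    by move/eqP: ki; rewrite cards_eq0 => /eqP/setP/(_ j); rewrite in_set jS ji inE.
  rewrite mem_selected_threshold; apply/idP/idP.
    case/orP=> [/and3P[_]|/is_m2_after_m1[m1 [m1P m1i _]]]; first by rewrite ltnS.
    by have := none _ m1i; rewrite mem_selected_threshold m1P.
  move=> di; have [m mi mP] := first_candidate_exists ci di.
  have [ltmi|im] := ltnP m i.
    by have := none _ ltmi; rewrite mem_selected_threshold /is_m1 mP.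
  suff <- : m = i by rewrite /is_m1 mP.
  by apply: val_inj; apply/eqP; rewrite eqn_leq mi.
have /cards1P[j jE] : #|[set j in selected K T R | j < i]| == 1 by apply/eqP.
have before l : l < i -> l \in selected K T R -> l = j.
  by move=> li lS; apply/set1P; rewrite -jE in_set lS.
have [jS ji] : j \in selected K T R /\ j < i.
  by move: (set11 j); rewrite -jE in_set => /andP.
(* If [j] were chosen as [m2], its [m1] would be used before [i] too, hence equal to [j]. *)
have j1 : is_m1 K d1 R j.
  move: (jS); rewrite mem_selected_threshold => /orP[//|/is_m2_after_m1[m1 [m1P m1j _]]].
  rewrite -(before m1) //; first exact: ltn_trans ji.
  by rewrite mem_selected_threshold m1P.
rewrite mem_selected_threshold; apply/idP/idP.
  case/orP=> [i1|/is_m2_after_m1[m1 [_ _ /and3P[_]]]].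
    by move: ji; rewrite (first_candidate_unique j1 i1) ltnn.
  by rewrite gtn_max ltnS => /andP[].
move=> di; have jdi : maxn j.+1 d2 <= i by rewrite geq_max ji.
have [m mi mP] := first_candidate_exists ci jdi.
have m2 : is_m2 K d1 d2 R m by apply/existsP; exists j; rewrite j1.
have [ltmi|im] := ltnP m i.
  have mj : m = j by apply: before => //; rewrite mem_selected_threshold m2 orbT.
  by case/and3P: mP => _; rewrite mj gtn_max ltnn.
suff <- : m = i by rewrite m2 orbT.
by apply: val_inj; apply/eqP; rewrite eqn_leq mi.
Qed.

End Threshold.

(** The equality case of optimality: accepting exactly when [x <= a] collects the whole gain, so the
    threshold rule loses nothing. *)
Lemma max_threshold (a x : rat) :
  (Num.max 0 (a - x) + (if x <= a then x else 0) = if x <= a then a else 0)%R.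
Proof.
by have [xa|ax] := leP x a; [rewrite max_r ?subr_ge0 // subrK | rewrite max_l ?addr0 //; lra].
Qed.

Theorem theorem5p1 (N K : nat) (hN : 1 <= N) (hK : 1 <= K <= N) :
  exists d1 d2 : nat,
    is_strategy K (threshold_strategy K d1 d2 : decisions N) /\
    forall D : decisions N, is_strategy K D ->
      (win_probability D
         <= win_probability (threshold_strategy K d1 d2 : decisions N))%R.
Proof.
have K0 : 0 < K by case/andP: hK.
have [w1 w1V] := value_exists N K0 (fun=> 0%R).
have [w2 w2V] := value_exists N K0 w1.
have [d1 d1P] := threshold_exists N K (x := fun n => w2 n - w1 n)%R
  (second_value_nonincreasing K0 w1V w2V).
have [d2 d2P] := threshold_exists N K (value_nonincreasing w1V).
exists d1, d2; set T := threshold_strategy K d1 d2.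
have TS : is_strategy K T by apply: threshold_is_strategy.
split=> // D DS; rewrite !(win_probabilityE K0) // ler_wpM2r ?invr_ge0 ?ler0n //.
(* Both indexed by the number of choices already used. *)
pose W k := if k is k'.+1 then if k' is _.+1 then fun=> 0%R else w1 else w2.
pose g k := if k is k'.+1 then if k' is _.+1 then fun=> 0%R else gain N K (fun=> 0%R) w1
            else gain N K w1 w2.
have WE k n : (W k n = \sum_(m < N | (n <= m)%N) (minn (m + K) N)%:R^-1 * g k m)%R.
  case: k => [|[|k]].
  - by apply: value_expand => //; case: w2V.
  - by apply: value_expand => //; case: w1V.
  - by rewrite big1 // => m _; rewrite mulr0.
have value D' (D'S : is_strategy K D') := sum_value K0 (@selected_candidate _ K D')
  (fun i => @selected_determined _ _ K0 _ i D'S) WE.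
have cand D' R (F : 'I_N -> rat) :
    (\sum_(i in selected K D' R) F i
     = \sum_(i | candidate K R i) (if i \in selected K D' R then F i else 0))%R.
  rewrite -big_mkcondr /=; apply: eq_bigl => i.
  by case: (boolP (i \in _)) => [/selected_candidate->|]; rewrite ?andbF.
(* The total of [W 0 0] separates the two strategies. By [sum_value] both comparisons reduce to
   single candidates: [D] collects at most the gain plus the value given up, and [T] at least
   that. *)
apply: (@le_trans _ _ (\sum_(R : {perm 'I_N}) W 0 0)%R).
  rewrite -(value D DS); apply: ler_sum => R _.
  rewrite !cand -big_split /=; apply: ler_sum => i _.
  have [iS|_] := boolP (i \in selected K D R); last first.
    by rewrite addr0; case: (used _ _ _) => [|[|k]]; rewrite ?gain_ge0.
  (* The applicant [i] is selected but not counted in [used], and at most two are selected. *)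
  have : used (selected K D) R i < 2.
    apply: leq_trans (card_selected R DS); apply/proper_card/properP.
    split; first by apply/subsetP => j; rewrite in_set => /andP[].
    by exists i; rewrite // in_set iS ltnn.
  by case: (used _ _ _) => [|[|//]] _ /=; rewrite /gain -lerBlDr le_max lexx orbT.
rewrite -(value T TS); apply: ler_sum => R _.
rewrite !cand -big_split /=; apply: ler_sum => i ci.
have [k0 k1] := used_threshold d1 d2 ci.
case: (used _ _ _) k0 k1 => [|[|k]] /=.
- by move=> /(_ erefl) -> _; rewrite d1P // max_threshold.
- by move=> _ /(_ erefl) ->; rewrite d2P // /gain subr0 max_threshold.
- move=> _ _; rewrite subrr; case: ifP => // _.
  by rewrite add0r divr_ge0.
Qed.
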